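(* Let $n\ge1$, $S\in\mathbb{R}^{n\times n}$ symmetric with zero diagonal, $\mu\in\mathbb{R}^n$, $\alpha\ge0$. As $p\to\infty$, the sequence $\{\Phi_p\}$ epi-converges on $\mathbb{R}^n$ to the indicator $\delta_{[-1,1]^n}$ of the box: $\Phi_p$ vanishes uniformly on the box (in the limit $p\to\infty$) and diverges to $+\infty$ pointwise outside it. Consequently, $U_{p,\alpha}$ epi-converges to $U_{\Box,\alpha}+\delta_{[-1,1]^n}$.
   Context: For integers $p\ge2$, $\Phi_p(\mathbf{x})=\sum_{i=1}^n|x_i|^{2p}/(2p)$, $\mathbf{x}\in\mathbb{R}^n$. $U_{\Box,\alpha}(\mathbf{x})=\tfrac{1-\alpha^2}{2}\|\mathbf{x}\|^2-\tfrac12\mathbf{x}^{\mathsf T}S\mathbf{x}-\mu\cdot\mathbf{x}$ (formula used on all of $\mathbb{R}^n$), and $U_{p,\alpha}=\Phi_p+U_{\Box,\alpha}$. $\delta_{[-1,1]^n}(\mathbf{x})=0$ if $\mathbf{x}\in[-1,1]^n$ and $+\infty$ otherwise. A sequence $f_p:\mathbb{R}^n\to(-\infty,+\infty]$ epi-converges to $f$ if for every $\mathbf{x}$: (a) $\liminf_p f_p(\mathbf{x}_p)\ge f(\mathbf{x})$ for every sequence $\mathbf{x}_p\to\mathbf{x}$, and (b) there exists a sequence $\mathbf{y}_p\to\mathbf{x}$ with $\limsup_p f_p(\mathbf{y}_p)\le f(\mathbf{x})$. *)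

(* Defs.v *)
From HB Require Import structures.
From mathcomp Require Import all_boot all_order all_algebra.
From mathcomp Require Import all_classical all_reals all_analysis.

Set Implicit Arguments.
Unset Strict Implicit.
Unset Printing Implicit Defensive.

Import Order.TTheory GRing.Theory Num.Theory.
Import numFieldNormedType.Exports.

Local Open Scope classical_set_scope.
Local Open Scope ring_scope.

(* The sequences are indexed by all p : nat, although only p >= 2 is meant:
   the first two terms (in particular the junk value Phi 0 = 0) affect none of
   the limits below. *)
Definition Phi (R : realType) (n p : nat) (x : 'cV[R]_n) : R :=
  \sum_(i < n) `|x i 0| ^+ (2 * p) / (2 * p)%:R.

(* The squared Euclidean norm is written x^T x, since the library norm `|x| on
   matrices is the sup norm (which induces the same topology). *)
Definition U_box (R : realType) (n : nat) (S : 'M[R]_n) (mu : 'cV[R]_n)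
    (alpha : R) (x : 'cV[R]_n) : R :=
  (1 - alpha ^+ 2) / 2 * (x^T *m x) 0 0
  - 1 / 2 * (x^T *m S *m x) 0 0 - (mu^T *m x) 0 0.

Definition U (R : realType) (n : nat) (S : 'M[R]_n) (mu : 'cV[R]_n)
    (alpha : R) (p : nat) (x : 'cV[R]_n) : R :=
  Phi p x + U_box S mu alpha x.

Definition box (R : realType) (n : nat) : set 'cV[R]_n :=
  [set x | forall i, -1 <= x i 0 <= 1].
Arguments box R n : clear implicits.

(* The indicator of convex analysis, not the 0/1-valued \1_A. *)
Definition delta (R : realType) (T : Type) (A : set T) (x : T) : \bar R :=
  if x \in A then 0%E else +oo%E.
Arguments delta {R T} A x.

Definition epi_converges (R : realType) (n : nat)
    (f_ : nat -> 'cV[R]_n -> \bar R) (f : 'cV[R]_n -> \bar R) : Prop :=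
  forall x : 'cV[R]_n,
    (forall x_ : nat -> 'cV[R]_n, x_ @ \oo --> x ->
       (f x <= limn_einf (fun p => f_ p (x_ p)))%E) /\
    (exists2 y_ : nat -> 'cV[R]_n, y_ @ \oo --> x &
       (limn_esup (fun p => f_ p (y_ p)) <= f x)%E).

(* Main.v *)
Require Import Defs.
From HB Require Import structures.
From mathcomp Require Import all_boot all_order all_algebra.
From mathcomp Require Import all_classical all_reals all_analysis.
From mathcomp Require Import ring.

(* On the box Phi p <= n / (2p). If x_p --> x and |x_i| > 1 then, for some d > 0
   and p large, 1 + d <= |(x_p)_i|, and Bernoulli's inequality gives
   Phi p (x_p) >= (p d)^2 / (2p) = p d^2 / 2, which diverges. *)

Import Order.TTheory GRing.Theory Num.Theory.
Import numFieldNormedType.Exports.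

Local Open Scope classical_set_scope.
Local Open Scope ring_scope.

(** The lower limit is the limit of the infima over tails, and these infima inherit the termwise
    order. *)
Lemma le_limn_einf (R : realType) (u v : nat -> \bar R) :
  (forall p, (u p <= v p)%E) -> (limn_einf u <= limn_einf v)%E.
Proof.
move=> uv; rewrite !limn_einf_lim; apply: lee_lim; [exact: is_cvg_einfs..|].
apply: nearW => p; apply: le_ereal_inf_tmp => _ [k pk <-].
by apply: le_trans (uv k); apply: ereal_inf_lbound; exists k.
Qed.

Lemma bernoulli_ineq (R : realType) (d : R) (p : nat) :
  0 <= d -> 1 + p%:R * d <= (1 + d) ^+ p.
Proof.
move=> d0; elim: p => [|p IHp]; first by rewrite mul0r addr0 expr0.
have d1 : 0 <= 1 + d by rewrite addr_ge0.
rewrite exprS; apply: le_trans (ler_wpM2l d1 IHp).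
rewrite -subr_ge0 -natr1.
have -> : (1 + d) * (1 + p%:R * d) - (1 + (p%:R + 1) * d) = p%:R * d ^+ 2.
  by ring.
by rewrite mulr_ge0// exprn_ge0.
Qed.

Lemma continuous_sumr (R : realType) (T : topologicalType) (n : nat)
    (F : 'I_n -> T -> R) :
  (forall i, continuous (F i)) -> continuous (fun x => \sum_(i < n) F i x).
Proof.
by move=> cF; apply: continuous_big => // x; exact: add_continuous.
Qed.

Section phi.
Context (R : realType) (n : nat).
Implicit Types (x mu : 'cV[R]_n) (A S : 'M[R]_n) (p : nat).

Let coord_cont i : continuous (fun x => x i 0 : R).
Proof. exact: coord_continuous. Qed.

Lemma continuous_linform mu : continuous (fun x => (mu^T *m x) 0 0 : R).
Proof.
under eq_fun do rewrite mxE.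
apply: continuous_sumr => i x.
by apply: continuousM; [exact: cst_continuous | exact: coord_cont].
Qed.

Lemma continuous_quadform A : continuous (fun x => (x^T *m A *m x) 0 0 : R).
Proof.
under eq_fun do rewrite mxE.
apply: continuous_sumr => j x.
apply: continuousM; last exact: coord_cont.
(* Each entry of the row [y^T *m A] is a linear form in [y], with coefficients in a column of
   [A]. *)
have -> : (fun y : 'cV[R]_n => (y^T *m A) 0 j) =
          (fun y => ((col j A)^T *m y) 0 0).
  by apply/funext => y; rewrite !mxE; apply: eq_bigr => i _; rewrite !mxE mulrC.
exact: continuous_linform.
Qed.

Lemma continuous_U_box S mu (alpha : R) : continuous (U_box S mu alpha).
Proof.
have cn : continuous (fun x : 'cV[R]_n => (x^T *m x) 0 0 : R).
  have -> : (fun x : 'cV[R]_n => (x^T *m x) 0 0) =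
            (fun x => (x^T *m 1%:M *m x) 0 0).
    by apply/funext => x; rewrite mulmx1.
  exact: continuous_quadform.
have cZ (c : R) (f : 'cV[R]_n -> R) : continuous f ->
    continuous (fun x => c * f x).
  by move=> cf x; apply: continuousM; [exact: cst_continuous | exact: cf].
move=> x; rewrite /U_box.
exact: (cvgB (cvgB (cZ _ _ cn x) (cZ _ _ (continuous_quadform S) x))
             (continuous_linform mu x)).
Qed.

Lemma Phi_ge0 p x : 0 <= Phi p x.
Proof. by apply: sumr_ge0 => i _; rewrite divr_ge0// exprn_ge0. Qed.

(** Each of the [n] summands is at most 1/(2p). At [p = 0] both sides are 0, because the inverse of
    0 is 0. *)
Lemma Phi_le_box p x : box R n x -> Phi p x <= n%:R / (2 * p)%:R.
Proof.
move=> bx; rewrite -[n in n%:R]card_ord -sum1_card natr_sum mulr_suml.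
apply: ler_sum => i _; rewrite ler_wpM2r ?invr_ge0//.
by rewrite exprn_ile1// ler_norml.
Qed.

Lemma Phi_ge_coord p x i (d : R) :
  0 <= d -> 1 + d <= `|x i 0| -> p%:R * (d ^+ 2 / 2) <= Phi p x.
Proof.
move=> d0 dx; case: p => [|p]; first by rewrite mul0r Phi_ge0.
rewrite /Phi (bigD1 i)//= ler_wpDr//.
  by apply: sumr_ge0 => j _; rewrite divr_ge0// exprn_ge0.
rewrite ler_pdivlMr//.
have -> : p.+1%:R * (d ^+ 2 / 2) * (2 * p.+1)%:R = (p.+1%:R * d) ^+ 2.
  by rewrite natrM; field.
have pd0 : 0 <= p.+1%:R * d by rewrite mulr_ge0.
(* Bernoulli is applied with exponent p and then squared: applied directly to 2p it gives only
   linear growth, which the denominator 2p cancels. *)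
rewrite mulnC exprM lerXn2r ?nnegrE ?exprn_ge0//.
apply: (@le_trans _ _ (1 + p.+1%:R * d)); first by rewrite lerDr.
apply: le_trans (bernoulli_ineq _ _ p.+1 d0) _.
by rewrite lerXn2r ?nnegrE ?addr_ge0.
Qed.

Lemma Phi_cvgy (x_ : nat -> 'cV[R]_n) x :
  x_ @ \oo --> x -> ~ box R n x -> Phi p (x_ p) @[p --> \oo] --> +oo.
Proof.
move=> x_x /existsNP[i xi].
have xi1 : 1 < `|x i 0| by rewrite ltNge ler_norml; apply/negP.
(* Half the excess over 1: [1 + d] lies strictly below the limit [|x i 0|], so the coordinates of
   [x_ p] eventually exceed it. *)
pose d := (`|x i 0| - 1) / 2.
have d0 : 0 < d by rewrite divr_gt0// subr_gt0.
have dx : 1 + d < `|x i 0|.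
  by rewrite -ltrBrDl /d ltr_pdivrMr// ltr_pMr ?subr_gt0// ltr1n.
have near_d : \forall p \near \oo, 1 + d <= `|x_ p i 0|.
  apply: (@cvgr_ge _ _ _ _ (fun p => `|x_ p i 0|) `|x i 0|) => //.
  apply: cvg_norm.
  exact: (cvg_comp _ _ x_x (@coord_cont i x)).
have d2 : 0 < d ^+ 2 / 2 by rewrite divr_gt0// exprn_gt0.
apply/cvgryPge => A; near=> p.
apply: (@le_trans _ _ (p%:R * (d ^+ 2 / 2))).
  by rewrite -ler_pdivrMr//; near: p; exact: nbhs_infty_ger.
by apply: (@Phi_ge_coord p _ i); [exact: ltW | near: p].
Unshelve. all: by end_near.
Qed.

Lemma cvg_Phi_bound : n%:R / (2 * p)%:R @[p --> \oo] --> (0 : R).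
Proof.
rewrite -[X in _ --> X](mulr0 n%:R); apply: cvgM; first exact: cvg_cst.
have dbl_cvgy : (2 * p)%:R @[p --> \oo] --> (+oo : set_system R).
  apply/cvgryPge => A; apply: filterS (nbhs_infty_ger A) => p /le_trans; apply.
  by rewrite ler_nat leq_pmull.
apply/gtr0_cvgV0 => //.
(* Positivity of 2p holds only from p = 1 on, which is enough for a limit. *)
by exists 1%N => //= p p0; rewrite ltr0n muln_gt0.
Qed.

(** The bound n/(2p) does not depend on the point, so a single rank [N] serves the whole box. *)
Lemma Phi_cvg_uniform :
  {uniform box R n, (fun p => @Phi R n p) @ \oo --> (fun=> 0 : R)}.
Proof.
move=> U /uniform_nbhs[E []]; rewrite -entourage_from_ballE => -[e e0 eE] EU.
have [N _ NE] := cvgr0_norm_lt _ cvg_Phi_bound e e0.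
exists N => // p /NE pe; apply: EU => x bx; apply: eE.
rewrite /= /ball /= sub0r normrN ger0_norm ?Phi_ge0//.
exact: le_lt_trans (Phi_le_box _ _ bx) (le_lt_trans (ler_norm _) pe).
Qed.

(* Adding a continuous [g] is harmless: the recovery sequence is constant, and
   along any x_p --> x the values g (x_p) are eventually bounded below, so they
   cannot compensate the blow-up of Phi p (x_p) outside the box. *)
Lemma epi_converges_Phi_add (g : 'cV[R]_n -> R) : continuous g ->
  epi_converges (fun p x => (Phi p x + g x)%:E)
    (fun x => ((g x)%:E + delta (box R n) x)%E).
Proof.
move=> cg x; rewrite /delta; case: ifPn => [/set_mem bx|/negP bx].
- rewrite adde0; split=> [x_ x_x|].
    (* Inside the box, dropping the nonnegative [Phi] leaves [g (x_ p)], whose lower limit is its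
       limit [g x]. *)
    have gx : (g (x_ p))%:E @[p --> \oo] --> (g x)%:E.
      by apply: cvg_EFin; [exact: nearW|exact: (cvg_comp _ _ x_x (cg x))].
    rewrite -(cvg_limn_einf_sup gx).1; apply: le_limn_einf => p.
    by rewrite lee_fin lerDr Phi_ge0.
  exists (fun=> x); first exact: cvg_cst.
  suff gx : (Phi p x + g x)%:E @[p --> \oo] --> (g x)%:E.
    by rewrite (cvg_limn_einf_sup gx).2.
  apply: cvg_EFin; first exact: nearW.
  rewrite -[X in _ --> X]add0r; apply: cvgD; last exact: cvg_cst.
  apply: squeeze_cvgr (@cvg_cst _ 0 _ _ _) cvg_Phi_bound.
  by apply: nearW => p; rewrite Phi_ge0 Phi_le_box.
(* Outside the box the target value is [+oo], so the upper bound is trivial and only the lower limit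
   needs an argument. *)
- rewrite addey//; split=> [x_ x_x|]; last first.
    by exists (fun=> x); [exact: cvg_cst | exact: leey].
  suff y : (Phi p (x_ p) + g (x_ p))%:E @[p --> \oo] --> +oo%E.
    by rewrite (cvg_limn_einf_sup y).1.
  apply/cvgeryP/cvgryPge => A.
  have gx : \forall p \near \oo, g x - 1 <= g (x_ p).
    apply: (@cvgr_ge _ _ _ _ (g \o x_) (g x)); last by rewrite ltrBlDr ltrDl.
    exact: (cvg_comp _ _ x_x (cg x)).
  have bx' : ~ box R n x by move=> /mem_set.
  (* The threshold is chosen so that adding the lower bound [g x - 1] gives exactly [A]. *)
  have /cvgryPge/(_ (A - (g x - 1))) PhiA := Phi_cvgy _ _ x_x bx'.
  near=> p; rewrite -[A](subrK (g x - 1)); apply: lerD; near: p; exact.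
Unshelve. all: by end_near.
Qed.

End phi.

Theorem proposition3 (R : realType) (n : nat) (hn : (1 <= n)%N)
    (S : 'M[R]_n) (S_sym : S^T = S) (S_diag : forall i, S i i = 0)
    (mu : 'cV[R]_n) (alpha : R) (alpha_ge0 : 0 <= alpha) :
  [/\ epi_converges (fun p (x : 'cV[R]_n) => (Phi p x)%:E) (delta (box R n)),
      {uniform box R n, (fun p => @Phi R n p) @ \oo --> (fun=> 0 : R)},
      (forall x : 'cV[R]_n, ~ box R n x -> Phi p x @[p --> \oo] --> +oo) &
      epi_converges (fun p (x : 'cV[R]_n) => (U S mu alpha p x)%:E)
        (fun x => ((U_box S mu alpha x)%:E + delta (box R n) x)%E)].
Proof.
split.
(* The statement for [Phi] alone is the perturbed one with [g = 0]. *)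
- have -> : (fun p (x : 'cV[R]_n) => (Phi p x)%:E) =
            (fun p x => (Phi p x + 0)%:E).
    by apply/funext => p; apply/funext => x; rewrite addr0.
  move=> x; rewrite -[delta _ x]add0e.
  by apply: (epi_converges_Phi_add _ _ (fun=> 0)); exact: cst_continuous.
- exact: Phi_cvg_uniform.
- by move=> x; apply: Phi_cvgy; exact: cvg_cst.
- by apply: epi_converges_Phi_add; exact: continuous_U_box.
Qed.
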